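(* Let $(P,\cdot)$ be a polygroupoid, and put $$N^1_{\lambda}(P,\cdot)=\{a\in P \mid a\cdot(x\cdot y)=(a\cdot x)\cdot y\ \ \forall\, x,y\in P\},$$ $$N^2_{\lambda}(P,\cdot)=\{a\in P \mid a\cdot(X\cdot y)=(a\cdot X)\cdot y\ \ \forall\, X\subseteq P,\ y\in P\},$$ $$N^3_{\lambda}(P,\cdot)=\{a\in P \mid a\cdot(x\cdot Y)=(a\cdot x)\cdot Y\ \ \forall\, Y\subseteq P,\ x\in P\},$$ $$N^4_{\lambda}(P,\cdot)=\{a\in P \mid a\cdot(X\cdot Y)=(a\cdot X)\cdot Y\ \ \forall\, X,Y\subseteq P\}.$$ Then the following are true: (a) $N^1_{\lambda}(P,\cdot)\subseteq N^2_{\lambda}(P,\cdot)$; (b) $N^1_{\lambda}(P,\cdot)\subseteq N^3_{\lambda}(P,\cdot)$; (c) $N^1_{\lambda}(P,\cdot)\subseteq N^4_{\lambda}(P,\cdot)$; (d) $N^2_{\lambda}(P,\cdot)\subseteq N^4_{\lambda}(P,\cdot)$; (e) $N^3_{\lambda}(P,\cdot)\subseteq N^4_{\lambda}(P,\cdot)$.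
   Context: A polygroupoid (also called a hypergroupoid) is a pair $(P,\cdot)$ where $P$ is a non-empty set and $\cdot: P\times P\to\mathcal{P}^{*}(P)$ is a hyperoperation, $\mathcal{P}^{*}(P)$ being the family of non-empty subsets of $P$. The hyperoperation is extended to subsets $A,B\subseteq P$ by $A\cdot B=\bigcup_{a\in A,\,b\in B} a\cdot b$, and an element $x\in P$ occurring in a product with a subset is identified with the singleton $\{x\}$; thus for $a,x,y\in P$, $a\cdot(x\cdot y)=\bigcup_{z\in x\cdot y} a\cdot z$ and $(a\cdot x)\cdot y=\bigcup_{w\in a\cdot x} w\cdot y$. The set $N^i_{\lambda}(P,\cdot)$, $i=1,2,3,4$, is called the first, second, third, fourth left nucleus of $(P,\cdot)$, respectively. *)

(* Defs.v *)
From mathcomp Require Import all_boot.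
From mathcomp Require Import classical_sets.

Set Implicit Arguments.
Unset Strict Implicit.
Unset Printing Implicit Defensive.

Local Open Scope classical_set_scope.

Record polygroupoid := Polygroupoid {
  carrier :> Type;
  carrier_nonempty : [set: carrier] !=set0;
  hop : carrier -> carrier -> set carrier;
  hop_nonempty : forall x y, hop x y !=set0
}.

Declare Scope hyper_scope.
Delimit Scope hyper_scope with H.
Notation "x ** y" := (hop x y) (at level 40, left associativity) : hyper_scope.
Local Open Scope hyper_scope.

(* The extension is to arbitrary subsets, the empty one included. *)
Definition hopS (P : polygroupoid) (A B : set P) : set P :=
  \bigcup_(a in A) \bigcup_(b in B) (a ** b).

Notation "A *** B" := (hopS A B) (at level 40, left associativity) : hyper_scope.

(* An element that multiplies a subset is written as a singleton; a product of
   two elements is the hyperoperation itself. *)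
Definition left_nucleus1 (P : polygroupoid) : set P :=
  [set a | forall x y : P, [set a] *** (x ** y) = (a ** x) *** [set y]].

Definition left_nucleus2 (P : polygroupoid) : set P :=
  [set a | forall (X : set P) (y : P),
     [set a] *** (X *** [set y]) = ([set a] *** X) *** [set y]].

Definition left_nucleus3 (P : polygroupoid) : set P :=
  [set a | forall (Y : set P) (x : P),
     [set a] *** ([set x] *** Y) = (a ** x) *** Y].

Definition left_nucleus4 (P : polygroupoid) : set P :=
  [set a | forall X Y : set P,
     [set a] *** (X *** Y) = ([set a] *** X) *** Y].

Arguments left_nucleus1 : clear implicits.
Arguments left_nucleus2 : clear implicits.
Arguments left_nucleus3 : clear implicits.
Arguments left_nucleus4 : clear implicits.

(* Main.v *)
Require Import Defs.
From mathcomp Require Import all_boot.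
From mathcomp Require Import classical_sets.

Local Open Scope classical_set_scope.

(** The product of subsets distributes over arbitrary unions in each argument
    ([hopS_bigcupl], [hopS_bigcupr]).  Hence both [a (X Y)] and [(a X) Y] are the
    unions, over [x] in [X] and [y] in [Y], of [a (x y)] and of [(a x) y], so an
    identity that holds on elements holds on all subsets: the first nucleus lies
    in the fourth.  Conversely the fourth condition specializes to the second and
    third by taking singletons, and each of these to the first, so the four
    nuclei coincide and every inclusion follows. *)

Local Open Scope hyper_scope.

Lemma hopS_set1 (P : polygroupoid) (x y : P) : [set x] *** [set y] = x ** y.
Proof. by rewrite /hopS !bigcup_set1. Qed.

Lemma hopS_bigcupl (P : polygroupoid) (I : Type) (D : set I) (F : I -> set P)
    (B : set P) :
  (\bigcup_(i in D) F i) *** B = \bigcup_(i in D) (F i *** B).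
Proof. exact: bigcup_bigcup. Qed.

Lemma hopS_bigcupr (P : polygroupoid) (I : Type) (D : set I) (A : set P)
    (F : I -> set P) :
  A *** (\bigcup_(i in D) F i) = \bigcup_(i in D) (A *** F i).
Proof.
apply/seteqP; split=> z.
- by move=> [a Aa [b [i Di Fb] zab]]; exists i => //; exists a => //; exists b.
- by move=> [i Di [a Aa [b Fb zab]]]; exists a => //; exists b => //; exists i.
Qed.

Lemma hopS_bigcup_set1r (P : polygroupoid) (A B : set P) :
  A *** B = \bigcup_(b in B) (A *** [set b]).
Proof. by rewrite -hopS_bigcupr bigcup_imset1 image_id. Qed.

Lemma left_nucleus1_sub4 (P : polygroupoid) :
  left_nucleus1 P `<=` left_nucleus4 P.
Proof.
move=> a Na X Y.
have -> : [set a] *** X = \bigcup_(x in X) (a ** x) by rewrite /hopS bigcup_set1.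
rewrite hopS_bigcupl [X *** Y]/hopS hopS_bigcupr.
apply: eq_bigcupr => x _; rewrite hopS_bigcupr [RHS]hopS_bigcup_set1r.
by apply: eq_bigcupr => y _; apply: Na.
Qed.

Lemma left_nucleus4_sub2 (P : polygroupoid) :
  left_nucleus4 P `<=` left_nucleus2 P.
Proof. by move=> a Na X y; apply: Na. Qed.

Lemma left_nucleus4_sub3 (P : polygroupoid) :
  left_nucleus4 P `<=` left_nucleus3 P.
Proof. by move=> a Na Y x; rewrite Na hopS_set1. Qed.

Lemma left_nucleus2_sub1 (P : polygroupoid) :
  left_nucleus2 P `<=` left_nucleus1 P.
Proof. by move=> a Na x y; have := Na [set x] y; rewrite !hopS_set1. Qed.

Lemma left_nucleus3_sub1 (P : polygroupoid) :
  left_nucleus3 P `<=` left_nucleus1 P.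
Proof. by move=> a Na x y; have := Na [set y] x; rewrite hopS_set1. Qed.

Theorem theorem3p1 (P : polygroupoid) :
  [/\ left_nucleus1 P `<=` left_nucleus2 P,
      left_nucleus1 P `<=` left_nucleus3 P,
      left_nucleus1 P `<=` left_nucleus4 P,
      left_nucleus2 P `<=` left_nucleus4 P
    & left_nucleus3 P `<=` left_nucleus4 P].
Proof.
split=> a Na.
- exact/left_nucleus4_sub2/left_nucleus1_sub4.
- exact/left_nucleus4_sub3/left_nucleus1_sub4.
- exact: left_nucleus1_sub4.
- exact/left_nucleus1_sub4/left_nucleus2_sub1.
- exact/left_nucleus1_sub4/left_nucleus3_sub1.
Qed.
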